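(* Let $D$ be a knot diagram, let $2\le k<\infty$, and let $M$ be the game matrix over $\mathbb{Z}_k$ of any version of the $k$-color region select game on $D$. Then $|Ker_k(M)|=k^2$.
   Context: Diagrams: a link (knot) diagram $D$ is the underlying graph of a regular projection of a link (knot) into $S^2$. Its vertices are the crossings, each of valence 4, and over/under information is ignored. Components without crossings are closed loops, each regarded as one edge with no vertices. Regions of $D$ are the connected components of $S^2\setminus D$. A vertex or edge is incident to a region if it lies in the boundary of that region. Two regions are adjacent if they are incident to a common edge. A vertex $v$ is reducible if some circle in $S^2$ meets $D$ transversely only at $v$, and irreducible otherwise. An irreducible vertex is incident to four distinct regions. A reducible vertex $v$ is incident to exactly three regions $r_0,r_1,r_2$, where $r_0$ touches $v$ from two sides and $r_1,r_2$ touch it from one side. A knot diagram with $n$ vertices has $n+2$ regions. A knot diagram is reduced if all its vertices are irreducible. Ring: for an integer $k\ge2$ let $\mathbb{Z}_k=\mathbb{Z}/k\mathbb{Z}$, and for $k=\infty$ let $\mathbb{Z}_\infty=\mathbb{Z}$. Game versions: a version of the $k$-color region select game on $D$ is a choice of an increment number $a(v,r)\in\mathbb{Z}_k$ for every incident vertex–region pair, subject to the following rules. - If $k<\infty$ and $v$ is irreducible, then $a(v,r)=a_v$ is the same for all regions $r$ incident to $v$, and $a_v$ is not a zero divisor of $\mathbb{Z}_k$. - If $k<\infty$ and $v$ is reducible, then $a(v,r_0)$ is arbitrary, while $a(v,r_1)$ and $a(v,r_2)$ are not zero divisors. - If $k=\infty$, then $a(v,r)=1$, except that $a(v,r_0)\in\mathbb{Z}$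 is arbitrary when $v$ is reducible. - The original game is the version in which all increment numbers equal $1$. Game matrix: enumerate the vertices as $v_1,\dots,v_n$ and the regions as $r_1,\dots,r_m$. The game matrix is the $n\times m$ matrix $M$ over $\mathbb{Z}_k$ with $M_{ij}=a(v_i,r_j)$ if $v_i$ is incident to $r_j$, and $M_{ij}=0$ otherwise. Patterns and configurations: a push pattern is a vector $\mathbf p\in\mathbb{Z}_k^m$, and $\mathbf p(r_j)=p_j$ is the number of times $r_j$ is pushed. A region $r$ is not pushed in $\mathbf p$ if $\mathbf p(r)=0$. A color configuration is a vector $\mathbf c\in\mathbb{Z}_k^n$. Applying $\mathbf p$ to $\mathbf c$ yields $\mathbf c+M\mathbf p$. The configuration $\mathbf c$ is solvable if some $\mathbf p$ satisfies $M\mathbf p=-\mathbf c$; such a $\mathbf p$ is a solving pattern for $\mathbf c$. $D$ is always solvable in the version if every $\mathbf c\in\mathbb{Z}_k^n$ is solvable. A null pattern is an element of $Ker_k(M)=\{\mathbf p\in\mathbb{Z}_k^m: M\mathbf p=0\}$. *)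

(* Defs.v *)
From HB Require Import structures.
From mathcomp Require Import all_boot all_order all_fingroup all_algebra.
Set Implicit Arguments. Unset Strict Implicit. Unset Printing Implicit Defensive.
Import GRing.Theory.
Local Open Scope ring_scope.

(* Knot diagrams with at least one crossing, as combinatorial maps.        *)
(* Darts (half-edges) form a finite type T.                                *)
(*   vs : rotation of the darts around each crossing (vertex) of D,        *)
(*   es : the fixed-point-free involution pairing the two darts of an edge *)
(*   faces are the orbits of  phi = es * vs  (d |-> vs (es d)).            *)
(* The dart e at vertex v stands for the corner of v between               *)
(* vs^-1 e and e, and this corner lies in the face (porbit phi e).         *)
(* Straight-ahead continuation through a crossing is d |-> vs^+2 (es d);   *)
(* each component of the diagram gives exactly two orbits of it (one per   *)
(* orientation), so a knot diagram has exactly two such orbits.            *)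
(* Planarity (embedding in S^2) is Euler's formula V - E + F = 2 for the   *)
(* connected map.                                                          *)

Definition face_perm (T : finType) (vs es : {perm T}) : {perm T} := (es * vs)%g.

Definition is_knot_diagram (T : finType) (vs es : {perm T}) : Prop :=
  (forall d, es (es d) = d /\ es d != d) /\
  (forall d, #|porbit vs d| = 4%N) /\
  (forall x y, connect (fun a b => (b == vs a) || (b == es a)) x y) /\
  (#|porbits vs| + #|porbits (face_perm vs es)| = #|porbits es| + 2)%N /\
      (* Euler: the connected map is drawn on S^2 *)
  #|porbits (es * vs ^+ 2)%g| = 2%N.                 (* exactly one component *)

Definition vertex (T : finType) (vs : {perm T}) := {S : {set T} | S \in porbits vs}.
Definition region (T : finType) (vs es : {perm T}) :=
  {F : {set T} | F \in porbits (face_perm vs es)}.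

Definition touch (T : finType) (vs es : {perm T})
  (v : vertex vs) (r : region vs es) : nat :=
  #|[set d in val v | porbit (face_perm vs es) d == val r]|.

Definition incident (T : finType) (vs es : {perm T})
  (v : vertex vs) (r : region vs es) : bool := (0 < touch v r)%N.

(* v is reducible iff some region touches v from two sides (equivalently,
   v is incident to fewer than four distinct regions). *)
Definition reducible (T : finType) (vs es : {perm T}) (v : vertex vs) : bool :=
  [exists r : region vs es, (1 < touch v r)%N].

Definition nzd (k : nat) (x : 'Z_k) : Prop := forall y : 'Z_k, x * y = 0 -> y = 0.

(* a : increment numbers of a version of the k-color region select game
   (only the values at incident pairs matter) *)
Definition is_version (k : nat) (T : finType) (vs es : {perm T})
  (a : vertex vs -> region vs es -> 'Z_k) : Prop :=
  forall v : vertex vs,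
    if reducible es v then
      (* r0 (touching twice) arbitrary, r1, r2 (touching once) not zero divisors *)
      forall r, touch v r = 1%N -> nzd (a v r)
    else
      exists av : 'Z_k, nzd av /\ forall r, incident v r -> a v r = av.

Definition game_matrix (k : nat) (T : finType) (vs es : {perm T})
  (a : vertex vs -> region vs es -> 'Z_k) (v : vertex vs) (r : region vs es) : 'Z_k :=
  if incident v r then a v r else 0.

Definition kernel (k : nat) (V R : finType) (M : V -> R -> 'Z_k) : {set {ffun R -> 'Z_k}} :=
  [set p : {ffun R -> 'Z_k} | [forall v : V, \sum_(r : R) M v r * p r == 0]].

(* Main.v *)
Require Import Defs.
From mathcomp Require Import all_boot all_order all_fingroup all_algebra zify.
Set Implicit Arguments. Unset Strict Implicit. Unset Printing Implicit Defensive.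
Import GRing.Theory.
Local Open Scope ring_scope.

(* There are two more regions than vertices, so the kernel has at least k^2
   elements. Conversely, a null pattern is determined by its values on the two
   regions at one edge. If all vertices are irreducible, going straight through a
   vertex negates the sum of a null pattern over the two sides of an edge; when
   the pattern vanishes on both sides of one edge, this sum is therefore zero
   along the whole knot, and the zeros spread from region to region. A reducible
   vertex is handled by cutting it along the region touching it twice: the Jordan
   curve property, extracted here from Euler's formula, makes the straight walk
   return to the same side of the cut by the other strand, so the argument works
   within each piece; the hypothesis on increments carries the zeros across the
   cut. *)

(** * Euler inequality for two permutations, via invariant two-colourings *)

Section EulerInequality.
Variable T : finType.
Implicit Types (x y s : {perm T}) (f : {ffun T -> bool}).

Definition invariant_colorings x y : {set {ffun T -> bool}} :=
  [set f : {ffun T -> bool} | [forall d, (f (x d) == f d) && (f (y d) == f d)]].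

Lemma invariant_coloringsP x y f :
  reflect (forall d, f (x d) = f d /\ f (y d) = f d) (f \in invariant_colorings x y).
Proof.
rewrite inE; apply: (iffP forallP) => H d; move: (H d).
  by case/andP => /eqP ? /eqP ?.
by case=> -> ->; rewrite !eqxx.
Qed.

Lemma card_porbits_mulr_tperm s (a b : T) :
  (#|porbits (s * tperm a b)%g| + (a \notin porbit s b).*2 = #|porbits s| + (a != b))%N.
Proof.
rewrite -porbitsV invMg tpermV -[porbits s]porbitsV -(porbitV s).
exact: porbits_mul_tperm.
Qed.

Lemma porbit_invariant s (f : T -> bool) :
  (forall d, f (s d) = f d) -> forall a b, a \in porbit s b -> f a = f b.
Proof.
move=> fs a b /porbitP[i ->]; elim: i => [|i IH]; first by rewrite expg0 perm1.
by rewrite expgSr permM fs.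
Qed.

(** Each set of [y]-orbits is a colouring. This serves the base case [x = 1] of the Euler
    inequality. *)
Lemma leq_card_invariant_colorings1 y :
  (2 ^ #|porbits y| <= #|invariant_colorings 1%g y|)%N.
Proof.
rewrite -card_powerset.
pose g (B : {set {set T}}) := [ffun d => porbit y d \in B].
have gE B d : g B d = (porbit y d \in B) by rewrite ffunE.
have ginj : {in powerset (porbits y) &, injective g}.
  move=> B C; rewrite !inE => sB sC eqg; apply/setP => X.
  have [/imsetP[d _ ->]|nX] := boolP (X \in porbits y); first by rewrite -!gE eqg.
  by rewrite (contraNF (subsetP sB X) nX) (contraNF (subsetP sC X) nX).
rewrite -(card_in_imset ginj); apply: subset_leq_card; apply/subsetP => f.
case/imsetP => B _ ->; apply/invariant_coloringsP => d; rewrite !gE perm1; split => //.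
by rewrite -[y d]/((y ^+ 1)%g d) porbit_perm.
Qed.

(** Adding one fixed colouring that separates [a] from [b] injects the colourings separating them
    into those that do not. *)
Lemma card_invariant_colorings_le2 (I I' : {set {ffun T -> bool}}) (a b : T) :
  (forall f, f \in I' -> f a = f b -> f \in I) ->
  (forall f g, f \in I' -> g \in I' -> [ffun d => f d (+) g d] \in I') ->
  (#|I'| <= 2 * #|I|)%N.
Proof.
move=> sub addI.
pose E := [set f in I' | f a == f b]; pose N := [set f in I' | f a != f b].
have EI : (#|E| <= #|I|)%N.
  by apply/subset_leq_card/subsetP => f; rewrite inE => /andP[fI /eqP]; exact: sub.
have NE : (#|N| <= #|E|)%N.
  have [->|[g]] := set_0Vmem N; first by rewrite cards0.
  rewrite inE => /andP[gI gab].
  have inj : injective (fun f : {ffun T -> bool} => [ffun d => f d (+) g d]).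
    move=> f f' /ffunP eq; apply/ffunP => d; move: (eq d); rewrite !ffunE.
    exact: addIb.
  rewrite -(card_imset _ inj); apply/subset_leq_card/subsetP => h /imsetP[f].
  rewrite inE => /andP[fI fab] ->; rewrite inE addI //= !ffunE.
  by case: (f a) (f b) (g a) (g b) fab gab => [] [] [] [].
have -> : I' = E :|: N.
  by apply/setP => f; rewrite !inE -andb_orr orbN andbT.
rewrite mul2n -addnn; apply: leq_trans (leq_card_setU _ _) _.
by apply: leq_add => //; apply: leq_trans EI.
Qed.

(* Counting the [2 ^ c] colourings invariant under x and y, instead of the c
   orbits of <x, y>, lets an added transposition be handled by cosets; this is
   z(x) + z(y) + z(xy) <= |T| + 2c. *)
Lemma euler_inequality x y :
  (2 ^ (#|porbits x| + #|porbits y| + #|porbits (x * y)%g|)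
     <= 2 ^ #|T| * #|invariant_colorings x y| ^ 2)%N.
Proof.
have [n] := ubnP (#|T| - #|porbits x|); elim: n x y => // n IH x y lt_n.
have [->|/eqP/permP x1] := eqVneq x 1%g.
  rewrite mul1g -addnA addnn -muln2 expnD expnM.
  apply: leq_mul; last by rewrite leq_exp2r // leq_card_invariant_colorings1.
  by rewrite leq_exp2l // leq_imset_card.
have [a xa] : exists a, x a != a.
  apply/existsP/negP => /existsP H; apply: x1 => d; rewrite perm1.
  by apply/eqP/negP => /negP ?; apply: H; exists d.
(* Moving [t] from one factor to the other keeps the product and splits a cycle of [x], since
   [x a = b]. *)
set b := x a in xa; pose t := tperm a b.
have inxb : a \in porbit x b by rewrite porbit_sym -[b]/((x ^+ 1)%g a) mem_porbit.
have neab : a != b by rewrite eq_sym.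
have zx : #|porbits (x * t)%g| = #|porbits x|.+1.
  by move: (card_porbits_mulr_tperm x a b); rewrite inxb neab /= addn0 addn1.
have xy : (x * t * (t * y))%g = (x * y)%g by rewrite !mulgA -[(x * t * t)%g]mulgA tperm2 mulg1.
have zT : (#|porbits (x * t)%g| <= #|T|)%N by apply: leq_imset_card.
have {}IH := IH (x * t)%g (t * y)%g _.
have {IH} := IH ltac:(lia); rewrite xy zx.
have zy := porbits_mul_tperm y a b; rewrite -/t neab /= in zy.
have fxt f : f a = f b -> forall d, f (t d) = f d.
  by move=> fab d; rewrite /t; case: tpermP => [->|->|] //.
have I'I f : f \in invariant_colorings (x * t)%g (t * y)%g -> f a = f b ->
    f \in invariant_colorings x y.
  move=> /invariant_coloringsP H fab; apply/invariant_coloringsP => d; split.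
    by have [<- _] := H d; rewrite permM fxt.
  have [_] := H (t d); rewrite permM tpermK fxt //.
(* If [t] also splits a cycle of [y], the exponent grows by 2 and the colourings at most double. *)
have [iny|niny] := boolP (a \in porbit y b).
  rewrite iny /= addn0 in zy.
  have le2 : (#|invariant_colorings (x * t)%g (t * y)%g| <= 2 * #|invariant_colorings x y|)%N.
    apply: (card_invariant_colorings_le2 I'I) => f g /invariant_coloringsP Hf /invariant_coloringsP Hg.
    by apply/invariant_coloringsP => d; rewrite !ffunE; have [-> ->] := Hf d; have [-> ->] := Hg d.
  have -> : (#|porbits x|.+1 + #|porbits (t * y)%g| + #|porbits (x * y)%g| =
            2 + (#|porbits x| + #|porbits y| + #|porbits (x * y)%g|))%N by rewrite zy addn1 addnS !addSn.
  rewrite expnD => le1; rewrite -(@leq_pmul2l (2 ^ 2)) //; apply: leq_trans le1 _.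
  by rewrite mulnCA leq_mul2l -expnMn leq_exp2r // le2 orbT.
(* Otherwise [t] merges two cycles of [y]: the exponent is unchanged, and [f a = f b] is forced
   because [a] and [b] share an orbit of [t * y]. *)
rewrite niny addn1 addn2 in zy; case: zy => zy.
have -> : (#|porbits x|.+1 + #|porbits (t * y)%g| + #|porbits (x * y)%g| =
            #|porbits x| + #|porbits y| + #|porbits (x * y)%g|)%N.
  by rewrite -zy addnS addSn.
move=> le1; apply: leq_trans le1 _; rewrite leq_mul2l leq_exp2r //.
apply/orP; right; apply/subset_leq_card/subsetP => f fI; apply: I'I => //.
move/invariant_coloringsP: fI => H.
have: a \in porbit (t * y)%g b.
  have := porbits_mul_tperm (t * y)%g a b; rewrite /= -/t mulgA tperm2 mul1g neab.
  by case: (a \in _) => //=; rewrite -zy; lia.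
by apply: porbit_invariant => d; have [] := H d.
Qed.

(** The Euler inequality gives at least four invariant colourings, and at most two are constant. *)
Lemma nonconstant_invariant_coloring x y :
  (#|T| + 4 <= #|porbits x| + #|porbits y| + #|porbits (x * y)%g|)%N ->
  exists f, (forall d, f (x d) = f d) /\ (forall d, f (y d) = f d) /\
            exists u w, f u != f w.
Proof.
move=> le4; have le := euler_inequality x y.
have {le}le16 : (2 ^ 4 <= #|invariant_colorings x y| ^ 2)%N.
  rewrite -(@leq_pmul2l (2 ^ #|T|)) ?expn_gt0 // -expnD.
  by apply: leq_trans le; rewrite leq_exp2l.
have [f /andP[fI /existsP[u /existsP[w fuw]]]] :
    exists f, (f \in invariant_colorings x y) && [exists u, exists w, f u != f w].
  apply/existsP; apply: contraT; rewrite negb_exists => /forallP H; exfalso.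
  suff: (#|invariant_colorings x y| <= 2)%N by move: le16; nia.
  rewrite -card_bool -(card_imset predT (f := fun b => [ffun _ : T => b])); last first.
    move=> b b' /ffunP eqb.
    have [d _|T0] := pickP T; first by have := eqb d; rewrite !ffunE.
    exfalso.
    have: (#|porbits x| + #|porbits y| + #|porbits (x * y)%g| <= #|T| + #|T| + #|T|)%N.
      by rewrite !leq_add // leq_imset_card.
    by move: le4; rewrite (eq_card0 T0); lia.
  apply/subset_leq_card/subsetP => f fI.
  have := H f; rewrite fI /= negb_exists => /forallP fc.
  have [d _|T0] := pickP T; last first.
    by apply/imsetP; exists true => //; apply/ffunP => d; have := T0 d.
  apply/imsetP; exists (f d) => //; apply/ffunP => e; rewrite ffunE.
  by have := fc e; rewrite negb_exists => /forallP/(_ d); rewrite negbK => /eqP.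
move/invariant_coloringsP: fI => H; exists f; do 2?split; try by move=> d; have [] := H d.
by exists u, w.
Qed.

End EulerInequality.

(** * Darts, edges and faces of a knot diagram *)

Lemma card_porbits_uniform (T : finType) (s : {perm T}) (n : nat) :
  (forall d, #|porbit s d| = n) -> #|T| = (#|porbits s| * n)%N.
Proof.
move=> sn; rewrite -cardsT; apply: card_uniform_partition => [X /imsetP[d _ ->] //|].
suff -> : porbits s = equivalence_partition (fun a b => b \in porbit s a) setT.
  apply: equivalence_partitionP => a b c _ _ _; split; first exact: porbit_id.
  by rewrite -eq_porbit_mem eq_sym => /eqP eqab; rewrite -!eq_porbit_mem eqab ?porbit_id // eq_porbit_mem.
apply/setP => X; apply/imsetP/imsetP => -[d _ ->]; exists d => //; by apply/setP => e; rewrite !inE.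
Qed.

Section KnotDiagram.
Variables (T : finType) (vs es : {perm T}).
Hypothesis knotD : is_knot_diagram vs es.

Local Notation phi := (face_perm vs es).
Local Notation straight := (es * vs ^+ 2)%g.
Local Notation opp d := (vs (vs d)).
Local Notation F d := (porbit phi d).

Lemma edge_permK d : es (es d) = d.
Proof. by case: knotD => /(_ d)[]. Qed.

Lemma edge_perm_neq d : es d != d.
Proof. by case: knotD => /(_ d)[]. Qed.

Lemma vertex_porbit d : porbit vs d =i [:: d; vs d; opp d; vs (opp d)].
Proof. by case: knotD => _ [/(_ d) d4] _ x; rewrite porbit_traject d4. Qed.

Lemma vertex_corners_uniq d : uniq [:: d; vs d; opp d; vs (opp d)].
Proof. by case: knotD => _ [/(_ d) d4] _; have := uniq_traject_porbit vs d; rewrite d4. Qed.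

Lemma vertex_perm4 d : opp (opp d) = d.
Proof. by case: knotD => _ [/(_ d) d4] _; have := iter_porbit vs d; rewrite d4. Qed.

Lemma straightE d : straight d = opp (es d).
Proof. by rewrite permM expgS expg1 permM. Qed.

Lemma face_permE d : phi d = vs (es d).
Proof. by rewrite permM. Qed.

Lemma face_face_perm d : F (vs (es d)) = F d.
Proof. by rewrite -face_permE -[phi d]/((phi ^+ 1)%g d) porbit_perm. Qed.

Lemma face_edge_perm d : F (es d) = F (vs d).
Proof. by rewrite -[in RHS](edge_permK d) face_face_perm. Qed.

Lemma coloring_constant (f : T -> bool) :
  (forall d, f (vs d) = f d) -> (forall d, f (es d) = f d) -> forall u w, f u = f w.
Proof.
move=> fv fe u w; case: knotD => _ [_ [/(_ u w) /connectP[p pth ->] _]].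
elim: p u pth => //= x p IH u /andP[/orP[]/eqP -> /IH <-]; by rewrite ?fv ?fe.
Qed.

Lemma edge_porbit_card d : #|porbit es d| = 2.
Proof.
rewrite (_ : porbit es d = [set d; es d]) ?cards2 1?eq_sym ?edge_perm_neq //.
apply/setP => x; rewrite !inE; apply/idP/orP.
  case/porbitP => i ->; elim: i => [|i IH]; first by left; rewrite expg0 perm1.
  rewrite expgSr permM; case: IH => /eqP->; first by right.
  by left; rewrite edge_permK.
case=> /eqP->; first exact: porbit_id.
by rewrite -[es d]/((es ^+ 1)%g d) mem_porbit.
Qed.

Lemma card_darts_edges : #|T| = (#|porbits es| * 2)%N.
Proof. exact/card_porbits_uniform/edge_porbit_card. Qed.

Lemma card_darts_vertices : #|T| = (#|porbits vs| * 4)%N.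
Proof. by apply: card_porbits_uniform; case: knotD => _ []. Qed.

(** Stated so that splitting one orbit in each of two of these permutations reaches the bound
    [#|T| + 4] of [nonconstant_invariant_coloring]. *)
Lemma euler_darts : (#|T| + 2 = #|porbits es| + #|porbits vs| + #|porbits phi|)%N.
Proof.
have [_ [_ [_ [eul _]]]] := knotD.
by rewrite card_darts_edges muln2 -addnn -addnA -eul !addnA.
Qed.

Lemma card_regions : #|porbits phi| = (#|porbits vs| + 2)%N.
Proof.
have [_ [_ [_ [eul _]]]] := knotD.
have := card_darts_edges; rewrite card_darts_vertices; move: eul; lia.
Qed.

(* A face lying on both sides of an edge: cutting the edge splits that face, so
   the Euler inequality makes the map disconnected. *)
Lemma bridge_coloring d : F d = F (vs d) ->
  exists f : T -> bool, (forall x, f (vs x) = f x) /\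
    forall x, f (es x) = f x (+) (x \in [:: d; es d]).
Proof.
move=> Fd; pose t := tperm d (es d).
have neq : d != es d by rewrite eq_sym edge_perm_neq.
have ine : d \in porbit es (es d).
  by rewrite porbit_sym -[es d]/((es ^+ 1)%g d) mem_porbit.
have inF : d \in F (es d) by rewrite -eq_porbit_mem face_edge_perm Fd.
have ze : #|porbits (t * es)%g| = (#|porbits es| + 1)%N.
  by have := porbits_mul_tperm es d (es d); rewrite /= ine neq addn0.
have zf : #|porbits (t * es * vs)%g| = (#|porbits phi| + 1)%N.
  by have := porbits_mul_tperm phi d (es d); rewrite /= inF neq addn0 mulgA.
have [|f [fe [fv [u [w fuw]]]]] := @nonconstant_invariant_coloring T (t * es)%g vs.
  rewrite ze zf; move: euler_darts; lia.
exists f; split => // x.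
have fx y : f (es (t y)) = f y by rewrite -[RHS]fe permM.
(* Equal colours here would make [f] invariant under [es] as well, hence constant by
   connectedness. *)
have fdd : f d != f (es d).
  apply: contraNneq fuw => fd; apply/eqP/coloring_constant => // y.
  by rewrite -[in RHS]fx /t; case: tpermP => [->|->|]; rewrite ?edge_permK.
rewrite !inE; have [->|nd] := eqVneq x d; first by move: fdd; case: (f d) (f (es d)) => [] [].
have [->|ne] := eqVneq x (es d); first by rewrite edge_permK; move: fdd; case: (f d) (f (es d)) => [] [].
by rewrite -[in RHS]fx /t tpermD 1?eq_sym //= addbF.
Qed.

(* A face touching a vertex at two opposite corners: splitting the vertex along
   a circle through that face disconnects the map. *)
Lemma pinch_coloring a : F a = F (opp a) ->
  exists f : T -> bool, (forall x, f (es x) = f x) /\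
    forall x, f (vs x) = f x (+) (vs x \in [:: a; opp a]).
Proof.
move=> Fa; pose t := tperm a (opp a).
have neq : a != opp a.
  by have := vertex_corners_uniq a; rewrite /= !inE !negb_or => /andP[/and3P[]].
have inv : a \in porbit vs (opp a) by rewrite porbit_sym vertex_porbit !inE eqxx !orbT.
have inF : a \in F (opp a) by rewrite -eq_porbit_mem Fa.
have zv : #|porbits (vs * t)%g| = (#|porbits vs| + 1)%N.
  by have := card_porbits_mulr_tperm vs a (opp a); rewrite /= inv neq addn0.
have zf : #|porbits (es * (vs * t))%g| = (#|porbits phi| + 1)%N.
  by have := card_porbits_mulr_tperm phi a (opp a); rewrite /= inF neq addn0 -mulgA.
have [|f [fe [fv [u [w fuw]]]]] := @nonconstant_invariant_coloring T es (vs * t)%g.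
  rewrite zv zf; move: euler_darts; lia.
exists f; split => // x.
have fx y : f (t (vs y)) = f y by rewrite -[RHS]fv permM.
have faa : f a != f (opp a).
  apply: contraNneq fuw => fa; apply/eqP/coloring_constant => // y.
  by rewrite -[in RHS]fx /t; case: tpermP => [->|->|].
rewrite -[in RHS]fx /t !inE; case: tpermP => [->|->|/eqP/negbTE-> /eqP/negbTE->].
- by rewrite eqxx /=; move: faa; case: (f a) (f (opp a)) => [] [].
- by rewrite eqxx orbT /=; move: faa; case: (f a) (f (opp a)) => [] [].
by rewrite addbF.
Qed.

(** * The straight walk along the knot *)

Lemma straight_iterS n d : (straight ^+ n.+1)%g d = opp (es ((straight ^+ n)%g d)).
Proof. by rewrite expgSr permM straightE. Qed.

Lemma reverse_straight_iter n d :
  es ((straight ^+ n)%g (es ((straight ^+ n)%g d))) = d.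
Proof.
elim: n => [|n IH]; first by rewrite !expg0 !perm1 edge_permK.
by rewrite [X in es (_ (es X))]straight_iterS expgS permM straightE edge_permK vertex_perm4.
Qed.

Lemma vertex_corners_neq d : [/\ d != vs d, d != opp d & d != vs (opp d)].
Proof.
by have := vertex_corners_uniq d; rewrite /= !inE !negb_or => /andP[/and3P[-> -> ->]].
Qed.

(** By reversal symmetry, a walk ending in its own reverse would have a midpoint: a dart fixed by
    [es] if [n] is even, by [opp] if [n] is odd. *)
Lemma straight_iter_neq_rev n d : (straight ^+ n)%g d != es d.
Proof.
apply/eqP; rewrite -(odd_double_half n) -addnn; set m := n./2.
have rev x : es ((straight ^+ m)%g x) = d -> x = es ((straight ^+ m)%g d).
  move/(congr1 es); rewrite edge_permK => eqx.
  by apply: (@perm_inj _ (straight ^+ m)%g); rewrite eqx -[RHS]edge_permK reverse_straight_iter.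
rewrite addnA expgD permM; case: (odd n) => /=.
  rewrite add1n straight_iterS => /(congr1 es); rewrite edge_permK => /rev /eqP.
  by rewrite eq_sym; have [_ /negbTE->] := vertex_corners_neq (es ((straight ^+ m)%g d)).
by rewrite add0n => /(congr1 es); rewrite edge_permK => /rev /eqP; rewrite eq_sym (negbTE (edge_perm_neq _)).
Qed.

(** The orbits of [d] and [es d] are distinct, so they are the only two orbits of a one-component
    diagram. *)
Lemma straight_iter_cover d x :
  (exists n, x = (straight ^+ n)%g d) \/ (exists n, es x = (straight ^+ n)%g d).
Proof.
have [_ [_ [_ [_ two]]]] := knotD.
have neq : porbit straight d != porbit straight (es d).
  rewrite eq_porbit_mem porbit_sym; apply/negP => /porbitP[n /eqP].
  by rewrite eq_sym (negbTE (straight_iter_neq_rev n d)).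
have: porbit straight x \in [set porbit straight d; porbit straight (es d)].
  rewrite (_ : [set _; _] = porbits straight) ?imset_f //.
  apply/eqP; rewrite eqEcard cards2 neq two andbT.
  by apply/subsetP => X; rewrite !inE => /orP[]/eqP->; apply: imset_f.
rewrite !inE !eq_porbit_mem => /orP[]/porbitP[n xE]; first by left; exists n.
right; apply/porbitP; rewrite porbit_sym; apply/porbitP; exists n; rewrite xE.
apply: (@perm_inj _ es); apply: esym.
exact: reverse_straight_iter n (es d).
Qed.

(** After crossing a bridge, the straight walk keeps the colour of [es d], as it never crosses back;
    yet it returns to [d], which has the other colour. *)
Lemma face_vertex_neq d : F d != F (vs d).
Proof.
apply/eqP => Fd; have [f [fv fe]] := bridge_coloring Fd.
have fn n : f ((straight ^+ n.+1)%g d) = f (es d).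
  elim: n => [|n IH]; first by rewrite expg1 straightE !fv.
  rewrite straight_iterS !fv; set x := (straight ^+ n.+1)%g d in IH *.
  rewrite fe !inE (negbTE (straight_iter_neq_rev _ _)) orbF.
  have [->|_] := eqVneq x d; last by rewrite IH addbF.
  by rewrite fe !inE eqxx.
have := fn #[straight]%g.-1; rewrite prednK ?order_gt0 // expg_order perm1.
by rewrite fe !inE eqxx; case: (f d).
Qed.

(** * Pinched corners and the two sides of a cut *)

Definition pinched a := F a == F (opp a).

Lemma pinched_opp a : pinched (opp a) = pinched a.
Proof. by rewrite /pinched vertex_perm4 eq_sym. Qed.

(** Jordan curve argument: the pinch colouring is constant along the face of [vs a], which avoids
    the cut, but differs at the opposite corners [vs a] and [vs (opp a)]. *)
Lemma pinched_exclusive a : pinched a -> ~~ pinched (vs a).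
Proof.
move=> /eqP pa; apply/eqP => pva; have [f [fe fv]] := pinch_coloring pa.
have [av ao avo] := vertex_corners_neq a.
have [_ ao' _] := vertex_corners_neq (vs a).
have fphi n : f ((phi ^+ n)%g (vs a)) = f (vs a).
  elim: n => [|n IH]; first by rewrite expg0 perm1.
  have := porbit_perm phi n.+1 (vs a); rewrite expgSr permM face_permE => Fx.
  rewrite fv fe IH !inE; have [xa|_] := eqVneq _ a.
    by move: Fx (face_vertex_neq a); rewrite xa => ->; rewrite eqxx.
  have [xa|_] := eqVneq _ (opp a); last by rewrite addbF.
  by move: Fx (face_vertex_neq a); rewrite xa -pa => ->; rewrite eqxx.
have /porbitP[n vE] : vs (opp a) \in F (vs a) by rewrite -eq_porbit_mem pva.
have := fphi n; rewrite -vE [f (vs (opp a))]fv !inE (eq_sym _ a) (negbTE avo).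
rewrite !(inj_eq perm_inj) (eq_sym (vs a)) (negbTE av) addbF [f (opp a)]fv !inE eqxx orbT.
by case: (f _).
Qed.

(** Going straight through the vertex of [a] passes exactly one of the corners [a] and [opp a],
    where the colour flips. *)
Lemma pinch_coloring_opp a (f : T -> bool) :
  (forall x, f (vs x) = f x (+) (vs x \in [:: a; opp a])) ->
  forall x, f (opp x) = f x (+) (x \in porbit vs a).
Proof.
move=> fv x; rewrite fv [f (vs x)]fv vertex_porbit -addbA; congr (_ (+) _).
have -> : (vs x \in [:: a; opp a]) = (x \in [:: vs (opp a); vs a]).
  by rewrite !inE -[in X in vs x == X](vertex_perm4 a) !(inj_eq perm_inj).
have -> : (opp x \in [:: a; opp a]) = (x \in [:: opp a; a]).
  by rewrite !inE -[in X in opp x == X](vertex_perm4 a) !(inj_eq perm_inj).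
have := vertex_corners_uniq a; rewrite /= !inE !negb_or.
case/and4P=> /and3P[n1 n2 n3] /andP[n4 n5] n6 _.
have [->|_] := eqVneq x a; first by rewrite (negbTE n1) (negbTE n2) (negbTE n3).
have [->|_] := eqVneq x (vs a); first by rewrite (negbTE n4) (negbTE n5).
have [->|_] := eqVneq x (opp a); first by rewrite (negbTE n6).
by case: eqVneq.
Qed.

(* Adjacency of darts once every reducible vertex is cut along its doubly
   touching region. *)
Definition smooth x y :=
  [|| y == es x, (y == vs x) && ~~ pinched y | (x == vs y) && ~~ pinched x].

Lemma smooth_vs x : ~~ pinched (vs x) -> smooth x (vs x).
Proof. by move=> px; rewrite /smooth eqxx px orbT. Qed.

Lemma smooth_vsV x : ~~ pinched (vs x) -> smooth (vs x) x.
Proof. by move=> px; rewrite /smooth eqxx px !orbT. Qed.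

Lemma smooth_es x : smooth x (es x).
Proof. by rewrite /smooth eqxx. Qed.

(** Steps of [smooth] avoid pinched corners, and [f] changes only at two of those. *)
Lemma pinch_coloring_smooth a (f : T -> bool) : pinched a ->
  (forall x, f (es x) = f x) ->
  (forall x, f (vs x) = f x (+) (vs x \in [:: a; opp a])) ->
  forall x y, connect smooth x y -> f x = f y.
Proof.
move=> pa fe fv x y /connectP[p pth ->]; elim: p x pth => //= z p IH x /andP[xz /IH <-].
have fp u : ~~ pinched (vs u) -> f (vs u) = f u.
  move=> pu; rewrite fv !inE.
  have [ua|_] := eqVneq _ a; first by rewrite ua pa in pu.
  have [ua|_] := eqVneq _ (opp a); first by rewrite ua pinched_opp pa in pu.
  by rewrite addbF.
case/or3P: xz => [/eqP->|/andP[/eqP->]|/andP[/eqP->]]; first by rewrite fe.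
  by move=> /fp ->.
by move=> /fp ->.
Qed.

(** * Null patterns read at corners, and the spreading of zeros *)

Section NullPattern.
Variables (A : zmodType) (P : T -> A).
Hypothesis P_face : forall a b, F a = F b -> P a = P b.
Hypothesis P_irreducible : forall d, ~~ pinched d -> ~~ pinched (vs d) ->
  P d + P (vs d) + P (opp d) + P (vs (opp d)) = 0.
Hypothesis P_reducible : forall d, pinched d -> P d = 0 -> P (vs d) = 0 ->
  P (vs (opp d)) = 0.

(** The corners [d] and [vs d] flank the dart [d], so they lie on the two sides of its edge. *)
Local Notation edge_sum d := (P d + P (vs d)).

Lemma edge_sum_rev d : edge_sum (es d) = edge_sum d.
Proof. by rewrite (P_face (face_edge_perm d)) (P_face (face_face_perm d)) addrC. Qed.

(* Seen from a smoothed component, the straight walk through the knot makes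
   excursions through pinched vertices; since the two sides of such a vertex
   meet only there, the walk returns along the other strand of that side. *)
Lemma edge_sum_straight d n : edge_sum d = 0 ->
  connect smooth d ((straight ^+ n)%g d) -> edge_sum ((straight ^+ n)%g d) = 0.
Proof.
move=> Z0; elim/ltn_ind: n => -[|n] IH; first by rewrite expg0 perm1.
rewrite straight_iterS; set y := (straight ^+ n)%g d; set w := es y => Cx.
(* At an irreducible vertex the walk stays in its smoothed component, and the two edge sums are
   opposite. *)
have [irr|red] := boolP (~~ pinched w && ~~ pinched (vs w)).
  have [pw pvw] := andP irr.
  have Cy : connect smooth d y.
    have pow : ~~ pinched (opp w) by rewrite pinched_opp.
    apply: connect_trans Cx _; apply: connect_trans (connect1 (smooth_vsV pow)) _.
    apply: connect_trans (connect1 (smooth_vsV pvw)) _.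
    by apply: connect1; rewrite -[y in smooth _ y]edge_permK smooth_es.
  have := P_irreducible pw pvw; rewrite edge_sum_rev (IH n) // add0r => ->.
  by [].
have [a pa aw] : exists2 a, pinched a & a = w \/ a = vs w.
  move: red; rewrite -negb_or negbK => /orP[]; first by exists w; [|left].
  by exists (vs w); [|right].
have [f [fe fv]] := pinch_coloring (eqP pa).
have aporb : porbit vs a =i porbit vs w.
  suff -> : porbit vs a = porbit vs w by [].
  by case: aw => -> //; rewrite -[vs w]/((vs ^+ 1)%g w) porbit_perm.
have fopp x : f (opp x) = f x (+) (x \in porbit vs w) by rewrite -aporb; apply: pinch_coloring_opp.
have fsm := pinch_coloring_smooth pa fe fv.
have fw : f (opp w) = ~~ f w by rewrite fopp porbit_id addbT.
have exj : exists j, f ((straight ^+ j)%g d) != f d.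
  by exists n; rewrite (fsm _ _ Cx) fw -/y -(fe y) -/w; case: (f w).
(* Step [m.+1] is the first change of side; it must happen at the vertex of [w], and before the walk
   reaches [w]. *)
case: (ex_minnP exj) => -[|m] fm minm; first by rewrite expg0 perm1 eqxx in fm.
have mn : (m < n)%N.
  by apply: minm; rewrite (fsm _ _ Cx) fw -/y -(fe y) -/w; case: (f w).
have fm0 : f ((straight ^+ m)%g d) = f d.
  by apply/eqP; apply: contraTT isT => /minm; rewrite ltnn.
move: fm; rewrite straight_iterS; set z := (straight ^+ m)%g d; set w' := es z.
have fw' : f w' = ~~ f w by rewrite /w' fe fm0 (fsm _ _ Cx).
rewrite fopp fw' (fsm _ _ Cx) fw => win.
have Zw' : connect smooth (opp w) w' -> edge_sum w' = 0.
  move=> Cw'; rewrite edge_sum_rev; apply: IH; first exact: ltnW.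
  apply: connect_trans Cx _; apply: connect_trans Cw' _; apply: connect1.
  by rewrite -[X in smooth _ X]edge_permK smooth_es.
have {win} : w' \in porbit vs w by move: win; case: (_ \in _); rewrite ?addbF ?eqxx.
(* [w] is on the wrong side, and [opp w] would make the walk run backwards. So [w'] is the other
   dart on the side of [opp w], and its edge has the same two regions beside it. *)
rewrite vertex_porbit !inE => /or4P[]/eqP w'E.
- by move: fw'; rewrite w'E; case: (f w).
- case: aw pa => -> pa.
    by move: (fsm _ _ (connect1 (smooth_vs (pinched_exclusive pa)))); rewrite -w'E fw'; case: (f w).
  have pw : ~~ pinched (opp w) by apply: pinched_exclusive.
  have := Zw' _; rewrite w'E => /(_ (connect1 (smooth_vsV pw))).
  by rewrite (P_face (eqP pa)) addrC.
- have := straight_iter_neq_rev (n.+1 - m) z.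
  rewrite [X in X != _](_ : _ = (straight ^+ n.+1)%g d); last first.
    by rewrite /z -permM -expgD subnKC // ltnW // ltnW.
  by rewrite straight_iterS -/y -/w -/w' w'E eqxx.
have := Zw' _; rewrite w'E; case: aw pa => -> pa.
  have pw : ~~ pinched (vs (opp w)) by apply: pinched_exclusive; rewrite pinched_opp.
  move=> /(_ (connect1 (smooth_vs pw))).
  by rewrite vertex_perm4 (P_face (eqP pa)) addrC.
exfalso; have pw : ~~ pinched w.
  by rewrite -pinched_opp; apply: pinched_exclusive.
have := fsm _ _ (connect1 (@smooth_vsV (vs (opp w)) _)).
by rewrite vertex_perm4 => /(_ pw); rewrite -w'E fw'; case: (f w).
Qed.

(** The walk from [d] traverses every edge in one direction or the other, and edge sums ignore
    direction. *)
Lemma edge_sum_smooth d x : edge_sum d = 0 -> connect smooth d x -> edge_sum x = 0.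
Proof.
move=> Z0 Cx; have [[n xE]|[n xE]] := straight_iter_cover d x.
  by rewrite xE; apply: edge_sum_straight; rewrite -?xE.
rewrite -edge_sum_rev xE; apply: edge_sum_straight; rewrite -?xE //.
exact: connect_trans Cx (connect1 (smooth_es x)).
Qed.

Lemma null_pattern_eq0 d : P d = 0 -> P (vs d) = 0 -> forall x, P x = 0.
Proof.
move=> Pd Pvd x; suff [] : P x = 0 /\ P (vs x) = 0 by [].
have [_ [_ [/(_ d x) /connectP[p pth ->] _]]] := knotD.
elim: p d Pd Pvd pth => //= y p IH d Pd Pvd /andP[/orP[]/eqP->]; last first.
  by apply: IH; rewrite ?(P_face (face_edge_perm d)) ?(P_face (face_face_perm d)).
apply: IH => //.
(* It remains to reach the corner [opp d]: it has the face of [d], or lies across the cut at [vs d],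
   or is reached by a vanishing edge sum. *)
have [pd|pd] := boolP (pinched d); first by rewrite -(P_face (eqP pd)).
have [pvd|pvd] := boolP (pinched (vs d)).
  have pvo : pinched (vs (opp d)) by rewrite pinched_opp.
  have := P_reducible pvo; rewrite vertex_perm4 -(P_face (eqP pvd)).
  by apply.
have := edge_sum_smooth _ (connect1 (smooth_vs pvd)).
by rewrite Pd Pvd !add0r; apply.
Qed.

End NullPattern.

(** * From corners back to regions, vertices and game versions *)

Definition region_of d : region vs es := exist _ (F d) (imset_f (porbit phi) isT).
Definition vertex_of d : vertex vs := exist _ (porbit vs d) (imset_f (porbit vs) isT).

Lemma region_of_eq c d : (region_of c == region_of d) = (F c == F d).
Proof. by rewrite -val_eqE. Qed.

Lemma region_ofP (r : region vs es) : exists d, r = region_of d.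
Proof. by case: r => X XP; have /imsetP[d _ XE] := XP; exists d; apply: val_inj. Qed.

Local Notation corner_regions d :=
  [:: region_of d; region_of (vs d); region_of (opp d); region_of (vs (opp d))].

Lemma touch_corners d r : touch (vertex_of d) r = count_mem r (corner_regions d).
Proof.
rewrite -[corner_regions d]/(map region_of [:: d; vs d; opp d; vs (opp d)]) count_map -size_filter.
rewrite -(card_uniqP (filter_uniq _ (vertex_corners_uniq d))).
by apply: eq_card => x; rewrite inE mem_filter /= vertex_porbit andbC -val_eqE.
Qed.

Lemma incident_corners d r : incident (vertex_of d) r = (r \in corner_regions d).
Proof. by rewrite /incident touch_corners -has_count has_pred1. Qed.

Lemma corner_regions_uniq d : ~~ pinched d -> ~~ pinched (vs d) -> uniq (corner_regions d).
Proof.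
move=> pd pvd; rewrite /= !inE !region_of_eq !negb_or !face_vertex_neq /=.
by rewrite [F d != F (opp d)]pd [F (vs d) != _]pvd eq_sym -[in X in _ != F X](vertex_perm4 d) face_vertex_neq.
Qed.

Lemma reducible_pinched d : reducible es (vertex_of d) = pinched d || pinched (vs d).
Proof.
apply/existsP/idP => [[r]|/orP[] pd].
- apply: contraTT; rewrite negb_or => /andP[pd pvd]; rewrite -leqNgt touch_corners.
  by rewrite count_uniq_mem ?corner_regions_uniq //; case: (_ \in _).
- exists (region_of d); rewrite touch_corners /= !region_of_eq eqxx.
  rewrite [F (opp d) == _]eq_sym [F d == F (opp d)]pd /=; lia.
exists (region_of (vs d)); rewrite touch_corners /= !region_of_eq eqxx.
rewrite [F (vs (opp d)) == _]eq_sym [F (vs d) == F (vs (opp d))]pd /=; lia.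
Qed.

Section Version.
Variables (k : nat) (a : vertex vs -> region vs es -> 'Z_k).
Hypothesis versionA : is_version a.
Variable p : {ffun region vs es -> 'Z_k}.
Hypothesis nullp : p \in kernel (game_matrix a).

Local Notation P d := (p (region_of d)).

Lemma kernel_face c d : F c = F d -> P c = P d.
Proof. by move=> cd; congr (p _); apply/eqP; rewrite region_of_eq cd. Qed.

Lemma kernel_irreducible d : ~~ pinched d -> ~~ pinched (vs d) ->
  P d + P (vs d) + P (opp d) + P (vs (opp d)) = 0.
Proof.
move=> pd pvd; have := versionA (vertex_of d).
rewrite reducible_pinched (negbTE pd) (negbTE pvd) => -[av [nz avE]]; apply: nz.
move: nullp; rewrite inE => /forallP/(_ (vertex_of d))/eqP.
rewrite (bigID (incident (vertex_of d))) /= [X in _ + X]big1 ?addr0; last first.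
  by move=> r /negbTE inc; rewrite /game_matrix inc mul0r.
rewrite (eq_bigr (fun r => av * p r)); last first.
  by move=> r inc; rewrite /game_matrix inc avE.
rewrite -mulr_sumr (eq_bigl _ _ (incident_corners d)).
rewrite -big_uniq ?corner_regions_uniq //= !big_cons big_nil addr0.
by rewrite !addrA.
Qed.

(** The arbitrary increment of the doubly touching region multiplies zero, so only the term of [r2]
    survives, and its increment cancels. *)
Lemma kernel_reducible d : pinched d -> P d = 0 -> P (vs d) = 0 -> P (vs (opp d)) = 0.
Proof.
move=> pd P0 Pv0; have := versionA (vertex_of d); rewrite reducible_pinched pd /=.
set r2 := region_of (vs (opp d)) => nz.
have Fdo : F d = F (opp d) by apply/eqP.
have touch1 : touch (vertex_of d) r2 = 1%N.
  rewrite touch_corners /= eqxx !region_of_eq -Fdo [F (vs d) == _](negbTE (pinched_exclusive pd)).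
  by rewrite Fdo (negbTE (face_vertex_neq _)).
apply: (nz _ touch1).
move: nullp; rewrite inE => /forallP/(_ (vertex_of d))/eqP.
rewrite (bigD1 r2) //= big1 ?addr0; first by rewrite /game_matrix /incident touch1.
move=> r nr2; rewrite /game_matrix incident_corners !inE (negbTE nr2) orbF.
case: ifP; last by rewrite mul0r.
case/or3P => /eqP->; rewrite ?P0 ?Pv0 ?mulr0 //.
by rewrite -(kernel_face Fdo) P0 mulr0.
Qed.

Lemma kernel_eq0 d : P d = 0 -> P (vs d) = 0 -> forall r, p r = 0.
Proof.
move=> P0 Pv0 r; have [x ->] := region_ofP r.
exact: (null_pattern_eq0 kernel_face kernel_irreducible kernel_reducible P0 Pv0).
Qed.

End Version.
End KnotDiagram.

(** * Counting the kernel *)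

Lemma kernelB (k : nat) (V R : finType) (M : V -> R -> 'Z_k) (p q : {ffun R -> 'Z_k}) :
  (forall v, \sum_r M v r * p r = \sum_r M v r * q r) ->
  [ffun r => p r - q r] \in kernel M.
Proof.
move=> pq; rewrite inE; apply/forallP => v.
rewrite (eq_bigr (fun r => M v r * p r - M v r * q r)); last by move=> r _; rewrite ffunE mulrBr.
by rewrite sumrB pq subrr.
Qed.

(** Subtracting a fixed point of a nonempty fibre of [L] injects that fibre into the kernel; summing
    over all fibres gives the bound. *)
Lemma card_kernel_lower (k : nat) (V R : finType) (M : V -> R -> 'Z_k) :
  (#|'Z_k| ^ #|R| <= #|'Z_k| ^ #|V| * #|kernel M|)%N.
Proof.
pose L (p : {ffun R -> 'Z_k}) : {ffun V -> 'Z_k} := [ffun v => \sum_r M v r * p r].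
rewrite -!card_ffun -[X in (X <= _)%N]sum1_card (partition_big L predT) //= -sum_nat_const.
apply: leq_sum => y _; have [q /eqP qy|L0] := pickP (fun q => L q == y); last by rewrite big_pred0.
have inj : injective (fun p : {ffun R -> 'Z_k} => [ffun r => p r - q r]).
  by move=> p p' /ffunP e; apply/ffunP => r; move: (e r); rewrite !ffunE => /addIr.
rewrite sum1_card -(card_imset _ inj); apply/subset_leq_card/subsetP => h /imsetP[p].
rewrite -qy => Lp ->; have /eqP/ffunP pq : L p == L q := Lp; apply: kernelB => v.
by move: (pq v); rewrite !ffunE.
Qed.

(* First conjunct: the knot diagram without crossings (one closed loop, no
   vertices, two regions): its game matrix is the empty 0 x 2 matrix.
   Second conjunct: knot diagrams with at least one crossing. *)
Theorem mainTheorem8 (k : nat) (hk : (2 <= k)%N) :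
  (forall M : 'I_0 -> 'I_2 -> 'Z_k, #|kernel M| = (k ^ 2)%N) /\
  (forall (T : finType) (vs es : {perm T}), is_knot_diagram vs es ->
   forall a : vertex vs -> region vs es -> 'Z_k, is_version a ->
   #|kernel (game_matrix a)| = (k ^ 2)%N).
Proof.
have kE : #|'Z_k| = k by rewrite card_ord Zp_cast.
split=> [M|T vs es knotD a versionA].
  rewrite (_ : kernel M = setT) ?cardsT ?card_ffun ?kE ?card_ord //.
  by apply/setP => p; rewrite !inE; apply/forallP => -[].
have cardV : #|{: vertex vs}| = #|porbits vs| by rewrite card_sig.
have cardR : #|{: region vs es}| = (#|porbits vs| + 2)%N.
  by rewrite card_sig -(card_regions knotD).
have [d _] : exists d : T, d \in T.
  have [_ [_ [_ [_ two]]]] := knotD.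
  have : (0 < #|porbits (es * vs ^+ 2)%g|)%N by rewrite two.
  by case/card_gt0P => X /imsetP[d _ _]; exists d.
apply/eqP; rewrite eqn_leq; apply/andP; split; last first.
  have := card_kernel_lower (game_matrix a).
  by rewrite cardV cardR kE expnD leq_pmul2l // expn_gt0 (ltnW hk).
(* The two coordinates are the regions on the two sides of one edge; [kernel_eq0], applied to
   differences, makes [ev] injective. *)
pose ev (p : {ffun region vs es -> 'Z_k}) := (p (region_of vs es d), p (region_of vs es (vs d))).
have inj : {in kernel (game_matrix a) &, injective ev}.
  move=> p q pK qK [e1 e2]; apply/ffunP => r; apply/eqP; rewrite -subr_eq0; apply/eqP.
  have : [ffun r => p r - q r] \in kernel (game_matrix a).
    apply: kernelB => v; move: pK qK; rewrite !inE.
    by move=> /forallP/(_ v)/eqP-> /forallP/(_ v)/eqP->.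
  move/(kernel_eq0 knotD versionA)/(_ d); rewrite !ffunE e1 e2 !subrr.
  by move=> /(_ erefl erefl r); rewrite ffunE.
rewrite -(card_in_imset inj); apply: leq_trans (max_card _) _.
by rewrite card_prod kE mulnn.
Qed.
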